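(* Let $(X,\tau,d)$ be a forward extended Polish space, $f:X\to(-\infty,\infty]$ a proper function, $p,q\in(1,\infty)$ with $\frac1p+\frac1q=1$, and $Q_tf(y)=\inf_{x\in X}\bigl\{f(x)+\frac{d(x,y)^p}{pt^{p-1}}\bigr\}$. For $y\in\mathscr D(f)$ and $t\in(0,t_*(y))$ we have $$\frac{d}{dt^+}[Q_tf(y)]+\frac1q\left(\frac{|D^-[Q_tf]|(y)}{\lambda_d(y)}\right)^q\le0,\qquad\frac{d}{dt^-}[Q_tf(y)]+\frac{|D^+[Q_tf]|(y)^q}{q}\le0.$$ In particular, $$\frac{d}{dt}[Q_tf(y)]+\frac{|D^+[Q_tf]|(y)^q}{q}\le0$$ with at most countably many exceptions of $t$ in $(0,t_*(y))$.
   Context: An asymmetric extended metric space $(X,d)$ is a set with $d:X\times X\to[0,\infty]$ such that $d(x,y)=0$ iff $x=y$, and $d(x,z)\le d(x,y)+d(y,z)$ (no symmetry). $B^+_x(r)=\{y:d(x,y)<r\}$. For $A\subset X$, $\lambda_d(A)=\inf\{\lambda\ge1: d(x,y)\le\lambda d(y,x)\ \forall x,y\in A\}$. $X_{[x]}=\{y:d(x,y)<\infty\}$. $(X,d)$ is a forward extended metric space if $X$ is a disjoint union of sets $X_{[x_\alpha]}$ and there are non-decreasing functions $\Theta_\alpha:(0,\infty)\to[1,\infty)$ with $\lambda_d(B^+_{x_\alpha}(r))\le\Theta_\alpha(r)$ for all $r>0$; it carries the topology generated by forward balls, which coincides with that of the symmetrized metric $\hat d(x,y)=\frac12(d(x,y)+d(y,x))$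 (the $d$-topology). It is forward complete if every sequence such that for all $\varepsilon>0$ there is $N$ with $d(x_i,x_j)<\varepsilon$ for $j\ge i\ge N$ converges in the $d$-topology. A forward extended Polish space $(X,\tau,d)$: (1) $(X,d)$ is a forward complete forward extended metric space; (2) $\tau$ is a Polish topology on $X$; (3) $d(x_i,x)\to0$ implies $x_i\to x$ in $\tau$; (4) $d$ is lower semi-continuous on $X\times X$ for $\tau\times\tau$. The pointwise reversibility is $\lambda_d(y)=\lim_{r\to0^+}\lambda_d(B^+_y(r))$. $f$ is proper if it is finite somewhere. $\mathscr D(f)=\{y\in X: d(x,y)<\infty\text{ for some }x\text{ with }f(x)<\infty\}$. For $y\in\mathscr D(f)$, $t_*(y)=\sup\{t>0:Q_tf(y)>-\infty\}$, with $t_*(y)=0$ if $Q_tf(y)=-\infty$ for all $t>0$. For a function $h:X\to[-\infty,\infty]$ and $x$ with $h(x)\in\mathbb R$, the slopes are $|D^+h|(x)=\limsup_{z\to x}\frac{[h(z)-h(x)]^+}{d(x,z)}$ and $|D^-h|(x)=\limsup_{z\to x}\frac{[h(x)-h(z)]^+}{d(x,z)}$ (limits in the $d$-topology; $0$ at isolated points). $\frac{d}{dt^\pm}$ denote right/left derivatives. *)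

(* Defs.v *)
From HB Require Import structures.
From mathcomp Require Import all_boot all_order all_algebra.
From mathcomp Require Import all_classical all_reals all_analysis.

Set Implicit Arguments.
Unset Strict Implicit.
Unset Printing Implicit Defensive.

Import Order.TTheory GRing.Theory Num.Theory.
Import numFieldNormedType.Exports.

Local Open Scope classical_set_scope.
Local Open Scope ring_scope.
Local Open Scope ereal_scope.

Definition is_polish (R : realType) (T : topologicalType) : Prop :=
  exists (M : metricType R) (g : T -> M) (g' : M -> T),
    [/\ cancel g g', cancel g' g, continuous g & continuous g'] /\
    (forall F : set_system M, ProperFilter F -> cauchy F ->
       exists x : M, F --> x) /\
    (exists S : set M, countable S /\ dense S).

Record asym_ext_metric (R : realType) (X : Type) (d : X -> X -> \bar R) :
    Prop := {
  aem_ge0 : forall x y, 0 <= d x y ;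
  aem_eq0 : forall x y, d x y = 0 <-> x = y ;
  aem_triangle : forall x y z, d x z <= d x y + d y z }.

Definition fwd_ball (R : realType) (X : Type) (d : X -> X -> \bar R)
    (x : X) (r : R) : set X :=
  [set y | d x y < r%:E].

Definition finite_class (R : realType) (X : Type) (d : X -> X -> \bar R)
    (x : X) : set X :=
  [set y | d x y < +oo].

(* [reversibility] and [pt_reversibility] are the lambda_d(A) and lambda_d(y)
   of the theory; the former is +oo when no constant works. *)
Definition reversibility (R : realType) (X : Type) (d : X -> X -> \bar R)
    (A : set X) : \bar R :=
  ereal_inf [set l%:E | l in [set l : R | (1 <= l)%R /\
    forall x y, A x -> A y -> d x y <= l%:E * d y x]].

Definition pt_reversibility (R : realType) (X : Type) (d : X -> X -> \bar R)
    (y : X) : \bar R :=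
  lim (reversibility d (fwd_ball d y r) @[r --> 0^'+]).

(* A copy of X carrying the d-topology, so that it can coexist with another
   topology given on X. *)
Definition fwd_top (R : realType) (X : choiceType) (d : X -> X -> \bar R) :
  Type := X.

HB.instance Definition _ (R : realType) (X : choiceType)
    (d : X -> X -> \bar R) :=
  Choice.on (fwd_top d).

HB.instance Definition _ (R : realType) (X : choiceType)
    (d : X -> X -> \bar R) :=
  @isSubBaseTopological.Build (fwd_top d) (set X)
    [set B | exists (x : X) (r : R), (0 < r)%R /\ B = fwd_ball d x r] id.

Record fwd_ext_metric (R : realType) (X : Type) (d : X -> X -> \bar R) :
    Prop := {
  fem_metric : asym_ext_metric d ;
  fem_classes : exists (I : Type) (c : I -> X) (Theta : I -> R -> R),
    [/\ trivIset setT (fun a => finite_class d (c a)),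
        \bigcup_a finite_class d (c a) = setT,
        (forall a r s, (0 < r)%R -> (r <= s)%R -> (Theta a r <= Theta a s)%R),
        (forall a r, (0 < r)%R -> (1 <= Theta a r)%R) &
        (forall a r, (0 < r)%R ->
           reversibility d (fwd_ball d (c a) r) <= (Theta a r)%:E)] }.

Definition fwd_cauchy (R : realType) (X : Type) (d : X -> X -> \bar R)
    (u : nat -> X) : Prop :=
  forall e : R, (0 < e)%R -> exists N : nat, forall i j : nat,
    (N <= i)%N -> (i <= j)%N -> d (u i) (u j) < e%:E.

Definition fwd_complete (R : realType) (X : choiceType)
    (d : X -> X -> \bar R) : Prop :=
  forall u : nat -> fwd_top d, fwd_cauchy d u ->
    exists x : fwd_top d, u @ \oo --> x.

Record fwd_ext_polish (R : realType) (X : topologicalType)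
    (d : X -> X -> \bar R) : Prop := {
  fep_metric : fwd_ext_metric d ;
  fep_complete : fwd_complete d ;
  fep_polish : is_polish R X ;
  fep_cvg : forall (u : nat -> X) (x : X),
    d (u i) x @[i --> \oo] --> 0 -> u @ \oo --> x ;
  fep_lsc : lower_semicontinuous (fun z : X * X => d z.1 z.2) }.

(* The general term has no indeterminate form when f > -oo. *)
Definition Qt (R : realType) (X : Type) (d : X -> X -> \bar R) (p : R)
    (f : X -> \bar R) (t : R) (y : X) : \bar R :=
  ereal_inf [set f x + (d x y `^ p) / (p * t `^ (p - 1))%:E | x in setT].

Definition Dset (R : realType) (X : Type) (d : X -> X -> \bar R)
    (f : X -> \bar R) : set X :=
  [set y | exists x, f x < +oo /\ d x y < +oo].

Definition tstar (R : realType) (X : Type) (d : X -> X -> \bar R) (p : R)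
    (f : X -> \bar R) (y : X) : \bar R :=
  if `[< forall t : R, (0 < t)%R -> Qt d p f t y = -oo >] then 0
  else ereal_sup [set t%:E | t in [set t : R | (0 < t)%R /\
                                               -oo < Qt d p f t y]].

(* Meaningful where h is finite. The limits are along punctured neighbourhoods
   in the d-topology; the case split is needed because [limf_esup] over the
   trivial filter of an isolated point is -oo. *)
Definition slope_desc (R : realType) (X : choiceType) (d : X -> X -> \bar R)
    (h : X -> \bar R) (x : X) : \bar R :=
  if `[< isolated [set: fwd_top d] x >] then 0
  else limf_esup (fun z : fwd_top d => maxe (h x - h z) 0 / d x z)
         (dnbhs (x : fwd_top d)).

Definition slope_asc (R : realType) (X : choiceType) (d : X -> X -> \bar R)
    (h : X -> \bar R) (x : X) : \bar R :=
  if `[< isolated [set: fwd_top d] x >] then 0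
  else limf_esup (fun z : fwd_top d => maxe (h z - h x) 0 / d x z)
         (dnbhs (x : fwd_top d)).

(* The function g has derivative l at t along the filter F of increments; the
   right, left and two-sided derivatives are F := 0^'+, 0^'-, 0^'. Since
   oo - oo = -oo, a finite l forces g t to be finite, and g to be finite along
   t + F. *)
Definition is_derive_along (R : realType) (F : set_system R) (g : R -> \bar R)
    (t l : R) : Prop :=
  (g (t + h)%R - g t) / h%:E @[h --> F] --> l%:E.

(* Main.v *)
Require Import Defs.
From HB Require Import structures.
From mathcomp Require Import all_boot all_order all_algebra.
From mathcomp Require Import all_classical all_reals all_analysis.
From mathcomp Require Import ring lra.
Import Order.TTheory GRing.Theory Num.Theory.
Import numFieldNormedType.Exports.
Local Open Scope classical_set_scope.
Local Open Scope ring_scope.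

Set Implicit Arguments.
Unset Strict Implicit.

(** In the variable s = t^(1-p) one has Q_t f(y) = G(s), where G is the infimum
    of the affine functions s |-> f(x) + s d(x,y)^p / p, hence concave and
    nondecreasing.  Its one-sided derivatives G'(s-) >= G'(s+) exist, and differ
    for at most countably many s.  Write G'(s+-) = D^p / p; the chain rule turns
    this into the derivative - D^p / (q t^p) of t |-> Q_t f(y), the sides being
    exchanged since t |-> s is decreasing.  It remains to bound the slopes by
    s D^(p-1).

    Ascending slope: near-minimizers at a slightly larger parameter are
    near-minimizers at s with d(x,y) <= D + o(1); using them as competitors at z
    gives Q_t f(z) - Q_t f(y) <= s ((D + d(y,z))^p - D^p) / p.

    Descending slope: points x with d(x,y) > D + o(1) are excluded from
    almost minimizing at z by comparison with G at a slightly smaller parameter.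
    For the others, f(x) + s d(x,z)^p / p >= G(s) - s D^(p-1) d(z,y), and the
    reversibility converts d(z,y) into d(y,z). *)

(** * Infima of affine functions and their one-sided derivatives *)

Section affine_envelope.
Context {R : realType} {I : Type} (S : set I) (u A : I -> R).
Hypotheses (S0 : S !=set0) (A_ge0 : forall i, S i -> 0 <= A i).

Definition affine_vals s : set R := [set u i + s * A i | i in S].
Definition env s : R := inf (affine_vals s).
(** Over the reals [inf] takes a default value on a set that is not bounded below, so [env s] is
    meaningful only under this condition. As the slopes are nonnegative, it passes from [s] to every
    larger parameter. *)
Definition env_dom s := has_lbound (affine_vals s).
Definition env_slope s x := (env x - env s) / (x - s).
Definition env_dl s := lim (env_slope s x @[x --> s^'-]).
Definition env_dr s := lim (env_slope s x @[x --> s^'+]).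

Lemma env_le s i : env_dom s -> S i -> env s <= u i + s * A i.
Proof. by move=> ds Si; apply: ge_inf => //; exists i. Qed.

Lemma env_approx s e : env_dom s -> 0 < e ->
  exists2 i, S i & u i + s * A i < env s + e.
Proof.
move=> ds e0; have hi : has_inf (affine_vals s).
  by split=> //; have [i Si] := S0; exists (u i + s * A i), i.
have [_ [i Si <-] h] := inf_adherent e0 hi; by exists i.
Qed.

Lemma env_dom_le s s' : env_dom s -> s <= s' -> env_dom s'.
Proof.
move=> [m ms] ss'; exists m => _ [i Si <-].
apply: (@le_trans _ _ (u i + s * A i)); first by apply: ms; exists i.
by rewrite lerD2l ler_wpM2r// A_ge0.
Qed.

Lemma env_homo s s' : env_dom s -> s <= s' -> env s <= env s'.
Proof.
move=> ds ss'; apply/ler_addgt0Pr => e e0.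
have [i Si /ltW h] := env_approx (env_dom_le ds ss') e0.
apply: le_trans h; apply: le_trans (env_le ds Si) _.
by rewrite lerD2l ler_wpM2r// A_ge0.
Qed.

(** A line almost minimizing at [b] lies above the envelope at [a] and at [c], so its slope
    separates the two chord slopes up to a small error. Cross-multiplication avoids quotients. *)
Lemma env_concave a b c : env_dom a -> a < b -> b < c ->
  (env c - env b) * (b - a) <= (env b - env a) * (c - b).
Proof.
move=> da ab bc; have db := env_dom_le da (ltW ab).
have dc := env_dom_le db (ltW bc).
apply/ler_addgt0Pr => e e0; have ca0 : 0 < c - a by lra.
(* The tolerance enters once with weight c - b and once with weight b - a; dividing [e] by c - a
   makes the total equal to [e]. *)
have [i Si h] := env_approx db (divr_gt0 e0 ca0).
have hc := env_le dc Si; have ha := env_le da Si.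
set e' := e / (c - a) in h.
have -> : e = e' * (c - b) + e' * (b - a).
  by rewrite /e'; field; rewrite gt_eqF.
have h1 : env c - env b <= (c - b) * A i + e' by lra.
have h2 : (b - a) * A i - e' <= env b - env a by lra.
have ba0 : 0 <= b - a by lra. have cb0 : 0 <= c - b by lra.
have := ler_wpM2r ba0 h1; have := ler_wpM2r cb0 h2; lra.
Qed.

Lemma env_slopeC s x : env_slope s x = env_slope x s.
Proof. by rewrite /env_slope -(opprB s x) invrN mulrN -mulNr opprB. Qed.

Lemma env_slope_anti a b c : env_dom a -> a < b -> b < c ->
  env_slope b c <= env_slope a b.
Proof.
move=> da ab bc; rewrite /env_slope ler_pdivrMr ?subr_gt0//.
rewrite mulrAC ler_pdivlMr ?subr_gt0//; exact: env_concave.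
Qed.

Lemma env_slope_ge0 a b : env_dom a -> a < b -> 0 <= env_slope a b.
Proof.
move=> da ab; rewrite divr_ge0// subr_ge0 ?env_homo// ltW//.
Qed.

(** Monotonicity in the free endpoint, on either side of [s] and across it, makes the one-sided
    derivatives a supremum (right) and an infimum (left) of chord slopes. *)
Lemma env_slope_mono s x x' : env_dom s -> env_dom x ->
  x != s -> x' != s -> x <= x' -> env_slope s x' <= env_slope s x.
Proof.
move=> ds dx xs x's; rewrite le_eqVlt => /predU1P[->//|xx'].
have [xls|] := ltrP x s.
  have [x'ls|] := ltrP x' s.
    have := env_concave dx xx' x'ls => h.
    rewrite env_slopeC (env_slopeC s x) /env_slope ler_pdivrMr ?subr_gt0//.
    rewrite mulrAC ler_pdivlMr ?subr_gt0//; nra.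
  rewrite le_eqVlt eq_sym (negbTE x's)/= => sx'.
  by rewrite (env_slopeC s x) env_slope_anti.
rewrite le_eqVlt eq_sym (negbTE xs)/= => sx.
have h := env_concave ds sx xx'.
have sx' := lt_trans sx xx'.
rewrite /env_slope ler_pdivrMr ?subr_gt0//.
by rewrite mulrAC ler_pdivlMr ?subr_gt0//; nra.
Qed.

Lemma env_dr_cvg a s : env_dom a -> a < s ->
  env_slope s x @[x --> s^'+] --> env_dr s /\
  (forall x, s < x -> env_slope s x <= env_dr s).
Proof.
move=> da as_; have ds := env_dom_le da (ltW as_).
have ub : has_ubound (env_slope s @` [set` `]s, +oo[]).
  exists (env_slope a s) => _ [x + <-]; rewrite /= in_itv/= andbT => sx.
  exact: env_slope_anti.
have := @nonincreasing_at_right_cvgr _ _ s (BInfty _ false) isT _ ub.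
have mono : {in `]s, +oo[ &, nonincreasing_fun (env_slope s)}.
  move=> x x'; rewrite !in_itv/= !andbT => sx sx' xx'.
  by apply: env_slope_mono => //; rewrite ?gt_eqF//;
    apply: env_dom_le ds (ltW _).
move=> /(_ mono) cv; rewrite /env_dr (cvg_lim _ cv)//; split=> // x sx.
by apply: ub_le_sup => //; exists x => //=; rewrite in_itv/= andbT.
Qed.

Lemma env_dl_cvg a s : env_dom a -> a < s ->
  env_slope s x @[x --> s^'-] --> env_dl s /\
  env_dl s <= env_slope s a.
Proof.
move=> da as_; have ds := env_dom_le da (ltW as_).
(* Reflection turns the left limit at [s] into a right limit at [- s]. The interval is closed at
   [- a], so the infimum is also compared with the chord at [a]. *)
have dom x : x \in `]- s, - a] -> [/\ env_dom (- x), - x < s & - x != s].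
  rewrite in_itv/= => /andP[sx xa].
  have xs : - x < s by rewrite ltrNl.
  by rewrite (lt_eqF xs); split=> //; apply: env_dom_le da _; rewrite lerNr.
have lb : has_lbound ((fun x => env_slope s (- x)) @` [set` `]- s, - a]]).
  exists 0 => _ [x /= /dom[dx xs _] <-]; rewrite env_slopeC.
  exact: env_slope_ge0.
have mono : {in `]- s, - a] &, nondecreasing_fun (fun x => env_slope s (- x))}.
  move=> x x' /dom[dx xs xs'] /dom[dx' x's x's'] xx'.
  by apply: env_slope_mono => //; rewrite lerN2.
have ltb : (BRight (- s) < BRight (- a))%O by rewrite bnd_simp ltrN2.
have /cvg_at_leftNP cv := nondecreasing_at_right_cvgr ltb mono lb.
rewrite /env_dl (cvg_lim _ cv)//; split=> //.
apply: ge_inf => //; exists (- a); last by rewrite opprK.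
by rewrite /= in_itv/= ltrN2 as_/=.
Qed.

Lemma env_dr_ge0 a s : env_dom a -> a < s -> 0 <= env_dr s.
Proof.
move=> da as_; have [_ /(_ (s + 1))] := env_dr_cvg da as_.
rewrite ltrDl => /(_ ltr01); apply: le_trans.
by apply: env_slope_ge0; rewrite ?ltrDl//; apply: env_dom_le da (ltW _).
Qed.

Lemma env_dr_le_dl a s : env_dom a -> a < s -> env_dr s <= env_dl s.
Proof.
move=> da as_; have [cr _] := env_dr_cvg da as_.
have [cl _] := env_dl_cvg da as_.
apply: (limr_ge (cvgP _ cl)); near=> x.
have ax : a < x by near: x; exact: nbhs_left_gt.
have xs : x < s by near: x; exact: nbhs_left_lt.
apply: (limr_le (cvgP _ cr)); near=> z.
rewrite (env_slopeC s x); apply: env_slope_anti => //.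
exact: env_dom_le da (ltW _).
Unshelve. all: by end_near. Qed.

(** The slope of the chord from [s] to [s'] lies between the two derivatives. Hence the gaps opened
    by distinct kinks are disjoint. *)
Lemma env_dl_le_dr a s s' : env_dom a -> a < s -> s < s' ->
  env_dl s' <= env_dr s.
Proof.
move=> da as_ ss'; have [_ /(_ _ ss')] := env_dr_cvg da as_.
have [_] := env_dl_cvg (env_dom_le da (ltW as_)) ss'.
by rewrite (env_slopeC s' s); exact: le_trans.
Qed.

(** A line almost minimizing at a slightly larger parameter s + h is also nearly minimal at [s];
    were it steeper than [k], it would exceed at s + h what the right derivative allows. *)
Lemma env_approx_dr a s k e : env_dom a -> a < s -> env_dr s < k -> 0 < e ->
  exists i, [/\ S i, u i + s * A i < env s + e & A i <= k].
Proof.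
move=> da as_ kd e0; have ds := env_dom_le da (ltW as_).
have [_ dr_ub] := env_dr_cvg da as_; have dr0 := env_dr_ge0 da as_.
have k0 : 0 < k by exact: le_lt_trans kd.
pose h := e / (2 * k); have h0 : 0 < h by rewrite divr_gt0 ?mulr_gt0.
have sh : s < s + h by rewrite ltrDl.
have := dr_ub _ sh.
rewrite /env_slope (addrC s) addrK ler_pdivrMr// (addrC h) => hsl.
(* With this tolerance the chosen line is below G(s) + h k = G(s) + e / 2 at s + h, which yields
   both conclusions. *)
have e1 : 0 < h * (k - env_dr s) by rewrite mulr_gt0// subr_gt0.
have [i Si hi] := env_approx (env_dom_le ds (ltW sh)) e1.
have A0 := A_ge0 Si.
have hk : h * k = e / 2 by rewrite /h; field; rewrite gt_eqF.
exists i; split=> //.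
- have : 0 <= h * A i by rewrite mulr_ge0// ltW.
  nra.
- rewrite -(ler_pM2l h0); have := env_le ds Si; nra.
Qed.

Lemma env_slope_lt_dl a s k : env_dom a -> a < s -> env_dl s < k ->
  exists s', [/\ env_dom s', s' < s & env s - env s' < k * (s - s')].
Proof.
move=> da as_ dk; have [cl _] := env_dl_cvg da as_.
near s^'- => x.
have ax : a < x by near: x; exact: nbhs_left_gt.
have xs : x < s by near: x; exact: nbhs_left_lt.
exists x; split=> //; first exact: env_dom_le da (ltW _).
rewrite -ltr_pdivrMr ?subr_gt0// -[X in X < _]/(env_slope x s) env_slopeC.
near: x; exact: (cvgr_lt _ cl).
Unshelve. all: by end_near. Qed.

End affine_envelope.

(** * Inequalities for real powers *)

Section powR_estimates.
Context {R : realType}.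
Implicit Types a b c p q : R.

(* This is Young's inequality applied to a `^ (p - 1) * c. *)
Lemma powR_le_tangent p q a b c : 1 < p -> 1 < q -> p^-1 + q^-1 = 1 ->
  0 <= a -> 0 <= c -> a <= c + b ->
  a `^ p <= c `^ p + p * a `^ (p - 1) * b.
Proof.
move=> p1 q1 pq a0 c0 acb.
have p0 : 0 < p by lra. have q0 : 0 < q by lra.
have pqD : p + q = p * q.
  by have := congr1 (fun x => x * (p * q)) pq; rewrite mul1r => <-; field; lra.
have Hp : a `^ p = a `^ (p - 1) * a by rewrite mulrC mulr_powRB1.
have := conjugate_powR c0 (powR_ge0 a (p - 1)) p0 q0 pq.
rewrite -powRrM (_ : (p - 1) * q = p); last by lra.
move=> H; have {}H : p * (c * a `^ (p - 1)) <= c `^ p + (p - 1) * a `^ p.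
  apply: le_trans (ler_wpM2l (ltW p0) H) _.
  rewrite mulrDr mulrCA divff ?gt_eqF// mulr1 lerD2l mulrCA.
  have -> : q^-1 = 1 - p^-1 by lra.
  by rewrite mulrBr mulr1 divff ?gt_eqF// mulrC.
have h := powR_ge0 a (p - 1).
have : p * a `^ (p - 1) * a <= p * a `^ (p - 1) * (c + b).
  by rewrite ler_wpM2l// mulr_ge0// ltW.
rewrite -mulrA -Hp; nra.
Qed.

(** The cases a < 1 and a >= 1 are each covered by one summand. This bounds the error of the tangent
    inequality by an affine function of the cost. *)
Lemma powR_subr1_le p a : 1 < p -> 0 <= a -> a `^ (p - 1) <= 1 + a `^ p.
Proof.
move=> p1 a0; have [a1|/ltW a1] := lerP a 1.
  apply: ler_wpDr; first exact: powR_ge0.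
  apply: le_trans (ge0_ler_powR _ _ _ a1) _; rewrite ?nnegrE ?powR1//; lra.
by rewrite ler_wpDl// ler_powR//; lra.
Qed.

End powR_estimates.

(** * Countability of the kinks of the envelope *)

Section env_countable.
Context {R : realType} {I : Type} (S : set I) (u A : I -> R).
Hypotheses (S0 : S !=set0) (A_ge0 : forall i, S i -> 0 <= A i).

(** A rational chosen strictly between the two one-sided derivatives determines the kink, because
    these gaps are disjoint. *)
Lemma countable_env_kink : countable [set s |
  (exists2 a, env_dom S u A a & a < s) /\ env_dr S u A s != env_dl S u A s].
Proof.
pose between s := [set r : rat | env_dr S u A s < ratr r < env_dl S u A s].
pose g s : rat := get (between s).
have gP s : (exists2 a, env_dom S u A a & a < s) ->
    env_dr S u A s != env_dl S u A s ->
    env_dr S u A s < ratr (g s) < env_dl S u A s.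
  move=> [a da as_] ne; apply: (@getPex _ (between s)).
  have lt : env_dr S u A s < env_dl S u A s.
    by rewrite lt_neqAle ne/= (env_dr_le_dl S0 A_ge0 da).
  by have [r /[!in_itv]] := rat_in_itvoo lt; exists r.
apply/pcard_injP => /=.
apply: (@ex_intro _ _ (pickle \o g)) => s s'.
move=> /set_mem[/= es ns] /set_mem[/= es' ns'] /(pcan_inj pickleK) gg.
have /andP[g1 g2] := gP _ es ns; have /andP[g3 g4] := gP _ es' ns'.
rewrite gg in g1 g2; move: es es' => [a da as_] [a' da' as'].
case: (ltgtP s s') => // ss'.
  have := env_dl_le_dr S0 A_ge0 da as_ ss'.
  by rewrite leNgt (lt_trans g1).
have := env_dl_le_dr S0 A_ge0 da' as' ss'.
by rewrite leNgt (lt_trans g3).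
Qed.

End env_countable.

(** * The change of variable s = t^(1-p) *)

Section power_reparametrization.
Context {R : realType} (p : R).
Hypothesis p1 : 1 < p.

Lemma ltr_powR1B (x y : R) : 0 < x -> x < y -> y `^ (1 - p) < x `^ (1 - p).
Proof.
move=> x0 xy; have y0 := lt_trans x0 xy.
rewrite -opprB !powRN ltf_pV2 ?posrE ?powR_gt0//.
by apply: gt0_ltr_powR; rewrite ?nnegrE ?subr_gt0 ?(ltW x0) ?(ltW y0).
Qed.

Lemma powR1B_cvg (t : R) : 0 < t ->
  (t + h) `^ (1 - p) @[h --> 0] --> t `^ (1 - p).
Proof.
move=> t0.
have : {for t, continuous (fun x : R => x `^ (1 - p))}.
  apply/differentiable_continuous/derivable1_diffP.
  by apply: derivable_powR; rewrite in_itv/= t0.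
rewrite /continuous_at => ct.
have th : t + h @[h --> (0 : R)] --> t.
  by rewrite -[X in _ --> X]addr0; apply: cvgD; [exact: cvg_cst|exact: cvg_id].
exact: (cvg_comp _ _ th ct).
Qed.

Lemma powR1B_cvg_right (t : R) : 0 < t ->
  (t + h) `^ (1 - p) @[h --> 0^'+] --> (t `^ (1 - p))^'-.
Proof.
move=> t0 P /= [e e0 eP].
suff : \forall h \near 0^'+, P ((t + h) `^ (1 - p)) by [].
near=> h.
have h0 : 0 < h by near: h; exact: nbhs_right_gt.
apply: eP => /=; last by apply: ltr_powR1B; lra.
near: h; apply: (@cvgr_dist_lt _ _ _ _ _ _ (t `^ (1 - p)) _ _ e0).
by apply: cvg_at_right_filter; exact: powR1B_cvg.
Unshelve. all: by end_near. Qed.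

Lemma powR1B_cvg_left (t : R) : 0 < t ->
  (t + h) `^ (1 - p) @[h --> 0^'-] --> (t `^ (1 - p))^'+.
Proof.
move=> t0 P /= [e e0 eP].
suff : \forall h \near 0^'-, P ((t + h) `^ (1 - p)) by [].
near=> h.
have h0 : h < 0 by near: h; exact: nbhs_left_lt.
have th : - t < h by near: h; apply: nbhs_left_gt; lra.
apply: eP => /=; last by apply: ltr_powR1B; lra.
near: h; apply: (@cvgr_dist_lt _ _ _ _ _ _ (t `^ (1 - p)) _ _ e0).
by apply: cvg_at_left_filter; exact: powR1B_cvg.
Unshelve. all: by end_near. Qed.

Lemma powR1B_quotient_cvg (t : R) : 0 < t ->
  ((t + h) `^ (1 - p) - t `^ (1 - p)) / h @[h --> 0^'] --> (1 - p) * t `^ (- p).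
Proof.
move=> t0; have [D E] := is_derive1_powR (1 - p) t0.
rewrite (_ : 1 - p - 1 = - p) in E; last by lra.
rewrite -E; apply: cvg_trans D; apply: near_eq_cvg; near=> h.
by rewrite /= /GRing.scale/= mulr1 (addrC h) mulrC.
Unshelve. all: by end_near. Qed.

(** Chain rule: the quotient is the product of the quotient of G and that of the power. The
    cancelled increment is nonzero because the power is strictly decreasing. *)
Lemma quotient_powR1B_cvg_right (G : R -> R) (t D : R) : 0 < t ->
  (G x - G (t `^ (1 - p))) / (x - t `^ (1 - p))
    @[x --> (t `^ (1 - p))^'-] --> D ->
  (G ((t + h) `^ (1 - p)) - G (t `^ (1 - p))) / h @[h --> 0^'+] -->
    D * ((1 - p) * t `^ (- p)).
Proof.
move=> t0 GD.
have H := cvgM (cvg_comp _ _ (powR1B_cvg_right t0) GD)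
  (cvg_dnbhs_at_right (powR1B_quotient_cvg t0)).
apply: (cvg_trans _ (H _)); apply: near_eq_cvg; near=> h => /=.
have h0 : 0 < h by near: h; exact: nbhs_right_gt.
rewrite mulrA divfK// subr_eq0 lt_eqF//; apply: ltr_powR1B => //; lra.
Unshelve. all: by end_near. Qed.

Lemma quotient_powR1B_cvg_left (G : R -> R) (t D : R) : 0 < t ->
  (G x - G (t `^ (1 - p))) / (x - t `^ (1 - p))
    @[x --> (t `^ (1 - p))^'+] --> D ->
  (G ((t + h) `^ (1 - p)) - G (t `^ (1 - p))) / h @[h --> 0^'-] -->
    D * ((1 - p) * t `^ (- p)).
Proof.
move=> t0 GD.
have H := cvgM (cvg_comp _ _ (powR1B_cvg_left t0) GD)
  (cvg_dnbhs_at_left (powR1B_quotient_cvg t0)).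
apply: (cvg_trans _ (H _)); apply: near_eq_cvg; near=> h => /=.
have h0 : h < 0 by near: h; exact: nbhs_left_lt.
have th : - t < h by near: h; apply: nbhs_left_gt; lra.
rewrite mulrA divfK// subr_eq0 gt_eqF//; apply: ltr_powR1B => //; lra.
Unshelve. all: by end_near. Qed.

End power_reparametrization.

(** * Stability of the envelope under a displacement of the endpoint *)

Section power_cost.
Context {R : realType} {I : Type} (S : set I) (u dist : I -> R) (p q : R).
Hypotheses (S0 : S !=set0) (dist_ge0 : forall i, S i -> 0 <= dist i).
Hypotheses (p1 : 1 < p) (q1 : 1 < q) (pq : p^-1 + q^-1 = 1).
Let A i : R := dist i `^ p / p.

(** In the application [dist i], [c] and [b] are d(x,y), d(x,z) and d(z,y). The radius is uniform in
    [i], so the infimum over [i] can be taken afterwards. For [dist i] at most [D] the tangent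
    inequality suffices; beyond [D] the strict bound on the left derivative is used. *)
Lemma env_perturb a s D : 0 < s -> env_dom S u A a -> a < s -> 0 < D ->
  p * env_dl S u A s < D `^ p ->
  exists2 r, 0 < r & forall i b c, S i -> 0 <= b -> b < r -> 0 <= c ->
    dist i <= c + b ->
    env S u A s - s * D `^ (p - 1) * b <= u i + s * (c `^ p / p).
Proof.
move=> s0 da as_ D0 dlD; have p0 : 0 < p := lt_trans ltr01 p1.
have A_ge0 i : S i -> 0 <= A i by move=> _; rewrite divr_ge0 ?powR_ge0 ?ltW.
have dlk : env_dl S u A s < D `^ p / p by rewrite ltr_pdivlMr// mulrC.
have [s' [ds' s's Hs']] := env_slope_lt_dl S0 A_ge0 da as_ dlk.
set m := D `^ p / p * (s - s') - (env S u A s - env S u A s').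
have m0 : 0 < m by rewrite subr_gt0.
have Dp0 : 0 < D `^ p by exact: powR_gt0.
have sD0 : 0 < s * (D `^ p + 1) by rewrite mulr_gt0// addr_gt0.
(* For [dist i] beyond [D] the error is at most s b (1 + p [A i]). The first bound lets (s - s')
   [A i] absorb its growth in [A i]; the second keeps the part left at [A i] = D^p / p below [m]. *)
pose r := Num.min ((s - s') / (p * s)) (m / (s * (D `^ p + 1))).
have ss0 : 0 < s - s' by rewrite subr_gt0.
have r0 : 0 < r by rewrite lt_min (divr_gt0 ss0) ?(divr_gt0 m0)// mulr_gt0.
exists r => // i b c Si b0; rewrite lt_min => /andP[].
rewrite !ltr_pdivlMr ?mulr_gt0 ?addr_gt0// => br1 br2 c0 ac.
have a0 := dist_ge0 Si.
have ds := env_dom_le A_ge0 da (ltW as_).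
have T : A i <= c `^ p / p + dist i `^ (p - 1) * b.
  rewrite /A ler_pdivrMr// mulrDl divfK ?gt_eqF//.
  have := powR_le_tangent p1 q1 pq a0 c0 ac; lra.
have sT : s * A i - s * (dist i `^ (p - 1) * b) <= s * (c `^ p / p).
  by rewrite -mulrBr ler_pM2l// lerBlDr.
have [aD|/ltW Da] := lerP (dist i) D.
  have := env_le ds Si => Es.
  have : dist i `^ (p - 1) <= D `^ (p - 1).
    by apply: ge0_ler_powR; rewrite ?nnegrE ?subr_ge0 ?(ltW p1) ?(ltW D0).
  move=> /(ler_wpM2r b0)/(ler_wpM2l (ltW s0)); lra.
(* Here i is far from optimal: the gap m > 0 of G at s' absorbs the error. *)
have Es' := env_le ds' Si.
have DA : D `^ p / p <= A i.
  rewrite ler_pM2r ?invr_gt0//.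
  by apply: ge0_ler_powR; rewrite ?nnegrE ?(ltW p0) ?(ltW D0).
have := powR_subr1_le p1 a0.
have -> : dist i `^ p = p * A i by rewrite /A mulrCA divff ?gt_eqF// mulr1.
move=> /(ler_wpM2r b0)/(ler_wpM2l (ltW s0)) W.
have Mb : 0 <= s * D `^ (p - 1) * b by rewrite !mulr_ge0 ?powR_ge0// ltW.
have K : 0 <= (s - s' - p * s * b) * (A i - D `^ p / p).
  by rewrite mulr_ge0// ?subr_ge0//; lra.
have E : p * s * b * (D `^ p / p) = s * b * D `^ p by field; lra.
rewrite /m in br2; nra.
Qed.

End power_cost.

Local Open Scope ereal_scope.

(** * The Hopf-Lax infimum at a fixed point as an envelope *)

Section hopf_lax_envelope.
Context {R : realType} {X : choiceType}.
Context (d : X -> X -> \bar R) (f : X -> \bar R).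
Context (p : R) (y : X).
Hypotheses (dm : asym_ext_metric d) (f_gtNy : forall x, -oo < f x).
Hypothesis p1 : (1 < p)%R.
Hypothesis yD : Dset d f y.

(** All other points contribute [+oo] to the infimum at [y], so a real-valued envelope over this set
    loses nothing. *)
Definition adm : set X := [set x | f x < +oo /\ d x y < +oo].
Definition cost (x : X) : R := (fine (d x y) `^ p / p)%R.
Let fv (x : X) : R := fine (f x).
Let wt (t : R) : R := (t `^ (1 - p))%R.

Let G := env adm fv cost.
Let dom := env_dom adm fv cost.

Let p_gt0 : (0 < p)%R. Proof. by rewrite (lt_trans _ p1). Qed.

Lemma adm0 : adm !=set0. Proof. exact: yD. Qed.

Lemma cost_ge0 x : adm x -> (0 <= cost x)%R.
Proof. by move=> _; rewrite divr_ge0 ?powR_ge0 ?ltW. Qed.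

Lemma Qt_term t z x : (0 < t)%R -> f x < +oo -> d x z < +oo ->
  f x + (d x z `^ p) / (p * t `^ (p - 1))%:E =
  (fv x + wt t * (fine (d x z) `^ p / p))%:E.
Proof.
move=> t0 fx dx.
have df : d x z \is a fin_num by rewrite ge0_fin_numE// (aem_ge0 dm).
have ff : f x \is a fin_num by rewrite fin_numElt f_gtNy fx.
have pt0 : (p * t `^ (p - 1) != 0)%R.
  by rewrite gt_eqF// mulr_gt0// powR_gt0.
rewrite -{1}(fineK df) poweR_EFin inver (negbTE pt0) -EFinM -(fineK ff) -EFinD.
by rewrite /wt -opprB powRN invfM/= invrK [X in _ = (_ + X)%:E]mulrC mulrA.
Qed.

Lemma Qt_le t z x : (0 < t)%R -> f x < +oo -> d x z < +oo ->
  Qt d p f t z <= (fv x + wt t * (fine (d x z) `^ p / p))%:E.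
Proof.
by move=> t0 fx dx; rewrite -Qt_term//; apply: ereal_inf_lbound; exists x.
Qed.

(** Since [f] never takes the value [-oo], a point with [f x] or [d x z] infinite contributes [+oo]
    and constrains nothing. *)
Lemma Qt_ge t z (m : \bar R) : (0 < t)%R ->
  (forall x, f x < +oo -> d x z < +oo ->
    m <= (fv x + wt t * (fine (d x z) `^ p / p))%:E) -> m <= Qt d p f t z.
Proof.
move=> t0 H; apply: le_ereal_inf_tmp => _ [x _ <-].
have [fx|] := ltP (f x) +oo; last first.
  rewrite leye_eq => /eqP ->; rewrite addye ?leey//.
  have : 0 <= d x z `^ p / (p * t `^ (p - 1))%:E.
    by rewrite mule_ge0 ?poweR_ge0// inve_ge0 lee_fin mulr_ge0 ?powR_ge0 ?ltW.
  by case: (_ / _).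
have [dx|] := ltP (d x z) +oo; first by rewrite Qt_term//; exact: H.
rewrite leye_eq => /eqP ->; rewrite poweRyr ?gt_eqF//.
have pt0 : (0 < p * t `^ (p - 1))%R by rewrite mulr_gt0// powR_gt0.
rewrite gt0_mulye ?addey ?leey//; last first.
  by rewrite inver gt_eqF// lte_fin invr_gt0.
by have := f_gtNy x; case: (f x).
Qed.

Lemma Qt_env t : (0 < t)%R -> dom (wt t) -> Qt d p f t y = (G (wt t))%:E.
Proof.
move=> t0 dt; apply/eqP; rewrite eq_le; apply/andP; split; last first.
  by apply: Qt_ge => // x fx dx; rewrite lee_fin; exact: env_le.
apply/lee_addgt0Pr => e e0.
have [x [fx dx] h] := env_approx adm0 dt e0.
by apply: le_trans (Qt_le t0 fx dx) _; rewrite -EFinD lee_fin ltW.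
Qed.

(** An admissible point bounds the infimum from above; it is therefore finite and itself serves as
    the lower bound. *)
Lemma Qt_gtNy_dom t : (0 < t)%R -> -oo < Qt d p f t y -> dom (wt t).
Proof.
move=> t0; have [x [fx dx]] := adm0.
have := Qt_le t0 fx dx; case E : (Qt d p f t y) => [r| |]// _ _.
exists r => _ [z [fz dz] <-]; rewrite -lee_fin -E; exact: Qt_le.
Qed.

(** A later time has a smaller weight, so the weight of [t] is interior to the domain of G, as its
    left derivative requires. *)
Lemma tstar_dom t : (0 < t)%R -> t%:E < tstar d p f y ->
  exists2 t', (t < t')%R & dom (wt t').
Proof.
move=> t0; rewrite /tstar; case: asboolP => [_|_].
  by rewrite lte_fin ltNge ltW.
move=> /ereal_sup_gt[_ [t' [t'0 Q'] <-]]; rewrite lte_fin => tt'.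
by exists t' => //; exact: Qt_gtNy_dom.
Qed.

End hopf_lax_envelope.

(** * Limits in the forward topology and pointwise reversibility *)

Section forward_topology.
Context {R : realType} {X : choiceType} (d : X -> X -> \bar R).
Hypothesis dm : asym_ext_metric d.

Lemma nbhs_fwd_ball (y : X) (r : R) : (0 < r)%R ->
  nbhs (y : fwd_top d) (fwd_ball d y r).
Proof.
move=> r0; apply: open_nbhs_nbhs; split; last first.
  by rewrite /fwd_ball/= (aem_eq0 dm y y).2// lte_fin.
exists [set fwd_ball d y r]; last by rewrite bigcup_set1.
by move=> _ ->; apply: finI_from1; exists y, r.
Qed.

Lemma limf_esup_fwd_le (g : fwd_top d -> \bar R) (y : X) (r : R) (M : \bar R) :
  (0 < r)%R -> (forall z, d y z < r%:E -> z <> y -> g z <= M) ->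
  limf_esup g (dnbhs (y : fwd_top d)) <= M.
Proof.
move=> r0 H; rewrite limf_esupE.
apply: (@le_trans _ _ (ereal_sup (g @` [set z | d y z < r%:E /\ z <> y]))).
  apply: ereal_inf_lbound; exists [set z | d y z < r%:E /\ z <> y] => //.
  rewrite /dnbhs/= /within/=; near=> z => zy; split; last exact/eqP.
  by near: z; exact: nbhs_fwd_ball.
by apply: ge_ereal_sup => _ [z [zr zy] <-]; exact: H.
Unshelve. all: by end_near. Qed.

(** The reversibility of a ball is monotone in its radius, so the limit is an infimum, and any
    larger [k] works on some ball around [y]. *)
Lemma pt_reversibilityP (y : X) : fwd_ext_metric d ->
  exists l : R, [/\ (1 <= l)%R, pt_reversibility d y = l%:E &
    forall k : R, (l < k)%R -> exists2 r : R, (0 < r)%R &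
      forall x z, d y x < r%:E -> d y z < r%:E -> d x z <= k%:E * d z x].
Proof.
move=> [_ [I [c [Th [_ cover _ _ Thb]]]]].
have revS (A B : set X) : A `<=` B -> reversibility d A <= reversibility d B.
  move=> AB; apply: ereal_inf_le_tmp => _ [l [l1 lP] <-]; exists l => //.
  by split=> // x z /AB Bx /AB Bz; exact: lP.
have rev1 (A : set X) : 1 <= reversibility d A.
  by apply: le_ereal_inf_tmp => _ [l [l1 _] <-]; rewrite lee_fin.
pose rho r := reversibility d (fwd_ball d y r).
have mono : {in `]0%R, +oo[ &, nondecreasing_fun rho}.
  move=> r s _ _ rs; apply: revS => x; rewrite /fwd_ball/= => h.
  by apply: lt_le_trans h _; rewrite lee_fin.
have cv := nondecreasing_at_right_cvge (BInfty _ false) isT mono.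
have E : pt_reversibility d y = ereal_inf (rho @` [set` `]0%R, +oo[]).
  exact: (cvg_lim _ cv).
have rev_fin : pt_reversibility d y \is a fin_num.
  rewrite fin_real//; apply/andP; split.
    rewrite E (@lt_le_trans _ _ 1) ?ltNyr//.
    by apply: le_ereal_inf_tmp => _ [r _ <-]; exact: rev1.
  (* Finiteness: the unit ball at [y] lies in the ball of radius d(c a, y) + 1 around the centre of
     its class, where [Th a] bounds the reversibility. *)
  have : (\bigcup_a finite_class d (c a)) y by rewrite cover.
  move=> [a _]; rewrite /finite_class/= => dy.
  have dyf : d (c a) y \is a fin_num by rewrite ge0_fin_numE// (aem_ge0 dm).
  have D0 : (0 <= fine (d (c a) y))%R by rewrite fine_ge0// (aem_ge0 dm).
  have r0 : (0 < fine (d (c a) y) + 1)%R by rewrite ltr_wpDl.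
  apply: (@le_lt_trans _ _ (Th a (fine (d (c a) y) + 1)%R)%:E);
    last exact: ltry.
  apply: le_trans (Thb a _ r0); rewrite E.
  apply: (@le_trans _ _ (reversibility d (fwd_ball d y 1))).
    by apply: ereal_inf_lbound; exists 1%R => //=; rewrite in_itv/= ltr01.
  apply: revS => x; rewrite /fwd_ball/= => h.
  apply: le_lt_trans (aem_triangle dm _ y _) _.
  by rewrite EFinD fineK// lee_ltD.
exists (fine (pt_reversibility d y)); rewrite fineK//; split=> //.
  by rewrite -lee_fin fineK// E; apply: le_ereal_inf_tmp => _ [r _ <-];
     exact: rev1.
move=> k; rewrite -lte_fin fineK// E => /ereal_inf_lt[_ [r + <-]].
rewrite /= in_itv/= andbT => r0 /ereal_inf_lt[_ [l [l1 lP] <-] lk].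
exists r => // x z yx yz; apply: le_trans (lP _ _ yx yz) _.
by apply: lee_wpmul2r; [exact: aem_ge0 dm _ _ | exact: ltW].
Qed.

End forward_topology.

(** * Upper bounds for the ascending and descending slopes *)

Section slopes.
Context {R : realType} {X : choiceType}.
Context (d : X -> X -> \bar R) (f : X -> \bar R).
Context (p q : R) (y : X).
Hypotheses (dm : asym_ext_metric d) (f_gtNy : forall x, -oo < f x).
Hypotheses (p1 : (1 < p)%R) (q1 : (1 < q)%R) (pq : (p^-1 + q^-1 = 1)%R).
Hypothesis yD : Dset d f y.

Let S := adm d f y.
Let fv (x : X) : R := fine (f x).
Let A := cost d p y.
Let wt (t : R) : R := (t `^ (1 - p))%R.
Let p0 : (0 < p)%R := lt_trans ltr01 p1.
Let A_ge0 : forall x, S x -> (0 <= A x)%R := fun x Sx => cost_ge0 p1 Sx.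
Let S0 : S !=set0 := adm0 yD.

Let fine_ge0_dist x z : (0 <= fine (d x z))%R.
Proof. by rewrite fine_ge0// (aem_ge0 dm). Qed.

Let distK x z : d x z < +oo -> (fine (d x z))%:E = d x z.
Proof. by move=> dxz; rewrite fineK// ge0_fin_numE// (aem_ge0 dm). Qed.

Lemma fine_dist_triangle x y' z : d x y' < +oo -> d y' z < +oo ->
  (d x z < +oo) /\ (fine (d x z) <= fine (d x y') + fine (d y' z))%R.
Proof.
move=> xy yz.
have xz : d x z < +oo.
  by apply: le_lt_trans (aem_triangle dm x y' z) _; exact: lte_add_pinfty.
by split=> //; rewrite -lee_fin EFinD !distK//; exact: aem_triangle.
Qed.

Lemma dist_gt0 x z : x <> z -> 0 < d x z.
Proof.
move=> xz; rewrite lt_neqAle (aem_ge0 dm) andbT eq_sym.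
by apply/eqP => /(aem_eq0 dm).
Qed.

Lemma slope_asc_le t a D : (0 < t)%R -> env_dom S fv A a -> (a < wt t)%R ->
  (0 < D)%R -> (p * env_dr S fv A (wt t) < D `^ p)%R ->
  slope_asc d (Qt d p f t) y <= (wt t * D `^ (p - 1))%:E.
Proof.
move=> t0 da as_ D0 drD; have s0 : (0 < wt t)%R by exact: powR_gt0.
rewrite /slope_asc; case: asboolP => [_|_].
  by rewrite lee_fin mulr_ge0 ?powR_ge0.
have dr0 := env_dr_ge0 S0 A_ge0 da as_.
(* The midpoint gives a radius D' < D still above the critical value; the room D - D' is left for
   d(y,z), so that d(x,z) stays at most [D] for the chosen competitor x. *)
pose P := ((p * env_dr S fv A (wt t) + D `^ p) / 2)%R.
have P1 : (p * env_dr S fv A (wt t) < P)%R by rewrite midf_lt.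
have P2 : (P < D `^ p)%R by rewrite midf_lt.
have P0 : (0 <= P)%R by apply: le_trans (ltW P1); rewrite mulr_ge0// ltW.
pose D' := (P `^ p^-1)%R.
have D'P : (D' `^ p = P)%R by rewrite -powRrM mulVf ?gt_eqF// powRr1.
have D'0 : (0 <= D')%R by exact: powR_ge0.
have D'D : (D' < D)%R.
  rewrite ltNge; apply/negP => DD'; move: P2; rewrite -D'P ltNge.
  by rewrite ge0_ler_powR ?nnegrE ?(ltW p0) ?(ltW D0).
have ds := env_dom_le A_ge0 da (ltW as_).
apply: (@limf_esup_fwd_le _ _ _ dm _ y (D - D')); first by rewrite subr_gt0.
move=> z zr zy; have yzf : d y z < +oo by exact: lt_trans zr (ltry _).
set e := fine (d y z); have eE : d y z = e%:E by rewrite distK.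
have e0 : (0 < e)%R by rewrite -lte_fin -eE dist_gt0// => /esym.
rewrite eE lte_fin in zr.
rewrite eE inver gt_eqF// lee_pdivrMr// -EFinM ge_max lee_fin.
rewrite !mulr_ge0 ?powR_ge0 ?(ltW e0)// andbT.
rewrite (Qt_env dm f_gtNy p1 yD t0 ds) leeBlDr// -EFinD.
apply/lee_addgt0Pr => e' e'0.
have drk : (env_dr S fv A (wt t) < P / p)%R by rewrite ltr_pdivlMr// mulrC.
have [i [[fi di] hi Ai]] := env_approx_dr S0 A_ge0 da as_ drk e'0.
have [izf iz] := fine_dist_triangle di yzf.
apply: le_trans (Qt_le dm f_gtNy p1 t0 fi izf) _.
rewrite -EFinD lee_fin -/(fv i) -/(wt t).
have aD' : (fine (d i y) <= D')%R.
  rewrite leNgt; apply/negP => D'a; move: Ai.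
  rewrite /A /cost ler_pM2r ?invr_gt0// leNgt -D'P.
  by rewrite gt0_ltr_powR ?nnegrE.
have cD : (fine (d i z) <= D)%R by rewrite /e in zr; lra.
have := powR_le_tangent p1 q1 pq (fine_ge0_dist i z) (fine_ge0_dist i y) iz.
have : (fine (d i z) `^ (p - 1) <= D `^ (p - 1))%R.
  by apply: ge0_ler_powR; rewrite ?nnegrE ?subr_ge0 ?(ltW p1) ?(ltW D0).
move=> /(ler_wpM2r (ltW e0)); rewrite -/e => H1 H2.
have H3 : (fine (d i z) `^ p / p <= A i + D `^ (p - 1) * e)%R.
  rewrite /A /cost ler_pdivrMr// mulrDl divfK ?gt_eqF//.
  have := ler_wpM2l (ltW p0) H1; lra.
have := ler_wpM2l (ltW s0) H3; lra.
Qed.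

Lemma slope_desc_le t a D k r : (0 < t)%R -> env_dom S fv A a -> (a < wt t)%R ->
  (0 < D)%R -> (p * env_dl S fv A (wt t) < D `^ p)%R ->
  (0 < k)%R -> (0 < r)%R ->
  (forall z, d y z < r%:E -> d z y <= k%:E * d y z) ->
  slope_desc d (Qt d p f t) y <= (wt t * D `^ (p - 1) * k)%:E.
Proof.
move=> t0 da as_ D0 dlD k0 r0 rev; have s0 : (0 < wt t)%R by exact: powR_gt0.
rewrite /slope_desc; case: asboolP => [_|_].
  by rewrite lee_fin !mulr_ge0 ?powR_ge0 ?(ltW k0).
have ds := env_dom_le A_ge0 da (ltW as_).
have [r' r'0 Hr'] := env_perturb S0 (fun x _ => fine_ge0_dist x y) p1 q1 pq
  s0 da as_ D0 dlD.
(* Within [r] the distance d(z,y) is at most k d(y,z); the second bound then makes it smaller than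
   the perturbation radius [r']. *)
apply: (@limf_esup_fwd_le _ _ _ dm _ y (Num.min r (r' / k)%R)).
  by rewrite lt_min r0 divr_gt0.
move=> z zr zy; have yzf : d y z < +oo by exact: lt_trans zr (ltry _).
set e := fine (d y z); have eE : d y z = e%:E by rewrite distK.
have e0 : (0 < e)%R by rewrite -lte_fin -eE dist_gt0// => /esym.
move: zr; rewrite eE lte_fin lt_min => /andP[er]; rewrite ltr_pdivlMr// => ekr'.
have dzy : d z y <= (k * e)%:E.
  by rewrite EFinM -eE; apply: rev; rewrite eE lte_fin.
have zyf : d z y < +oo by exact: le_lt_trans dzy (ltry _).
set b := fine (d z y); have b0 : (0 <= b)%R by exact: fine_ge0_dist.
have be : (b <= k * e)%R by rewrite -lee_fin distK.
rewrite inver gt_eqF// lee_pdivrMr// -EFinM ge_max lee_fin.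
rewrite !mulr_ge0 ?powR_ge0 ?(ltW e0) ?(ltW k0)// andbT.
rewrite (Qt_env dm f_gtNy p1 yD t0 ds) -/S -/(wt t).
set K := (wt t * D `^ (p - 1))%R.
have K0 : (0 <= K)%R by rewrite mulr_ge0 ?powR_ge0.
have H : (env S fv A (wt t) - K * b)%:E <= Qt d p f t z.
  apply: Qt_ge => // x fx dxz; rewrite lee_fin.
  have [dxy h] := fine_dist_triangle dxz zyf.
  apply: Hr' => //; rewrite -/b; lra.
have KK : (K * b <= K * k * e)%R by rewrite -mulrA ler_wpM2l.
move: H; case: (Qt d p f t z) => [v| |]//.
  rewrite lee_fin -EFinB lee_fin => ?; lra.
by rewrite leNye.
Qed.

End slopes.

(** * Nonnegativity of the slopes *)

Section slopes_nonnegative.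
Context {R : realType} {X : choiceType} (d : X -> X -> \bar R).
Hypothesis dm : asym_ext_metric d.

(** If the empty set were a punctured neighbourhood of [y], then [y] would be isolated; so the
    filter is proper and the upper limit keeps the sign. *)
Let limf_esup_fwd_ge0 (g : fwd_top d -> \bar R) (y : X) :
  ~ isolated [set: fwd_top d] y -> (forall z, 0 <= g z) ->
  0 <= limf_esup g (dnbhs (y : fwd_top d)).
Proof.
move=> niso g0; apply: limf_esup_ge0 => //; rewrite /dnbhs/= => y0.
apply: niso; split; first by rewrite inE.
exists [set y : fwd_top d]; last by rewrite setIT.
rewrite /within/= in y0; apply: (@filterS _ _ _ _ _ _ y0) => z /= zy.
by apply/eqP/negPn/negP => /zy.
Qed.

Lemma slope_asc_ge0 (h : X -> \bar R) (y : X) : 0 <= slope_asc d h y.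
Proof.
rewrite /slope_asc; case: asboolP => // niso; apply: limf_esup_fwd_ge0 => // z.
by rewrite mule_ge0 ?inve_ge0 ?(aem_ge0 dm)// le_max lexx orbT.
Qed.

Lemma slope_desc_ge0 (h : X -> \bar R) (y : X) : 0 <= slope_desc d h y.
Proof.
rewrite /slope_desc; case: asboolP => // niso; apply: limf_esup_fwd_ge0 => // z.
by rewrite mule_ge0 ?inve_ge0 ?(aem_ge0 dm)// le_max lexx orbT.
Qed.

End slopes_nonnegative.

(** * From slope bounds to the Hamilton-Jacobi inequality *)

Section hamilton_jacobi.
Context {R : realType}.

(** Since (p - 1) q = p, the q-th power of the bound is t^(-p) D^p. As D^p decreases to p c,
    division by [q] gives (p - 1) c t^(-p), which cancels the derivative term. Staying above the
    critical value also handles c = 0. *)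
Lemma hamilton_jacobi_le (p q t c : R) (x : \bar R) :
  (1 < p)%R -> (1 < q)%R -> (p^-1 + q^-1 = 1)%R -> (0 < t)%R -> (0 <= c)%R ->
  0 <= x ->
  (forall D, (0 < D)%R -> (p * c < D `^ p)%R ->
    x <= (t `^ (1 - p) * D `^ (p - 1))%:E) ->
  (c * ((1 - p) * t `^ (- p)))%:E + (q^-1)%:E * x `^ q <= 0.
Proof.
move=> p1 q1 pq t0 c0 x0 H.
have p0 : (0 < p)%R := lt_trans ltr01 p1.
have q0 : (0 < q)%R := lt_trans ltr01 q1.
have pqD : (p + q = p * q)%R.
  have := congr1 (fun x => x * (p * q))%R pq.
  by rewrite mul1r => <-; field; lra.
apply/lee_addgt0Pr => e e0; rewrite add0e.
have tp0 : (0 < t `^ (- p))%R by exact: powR_gt0.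
(* The excess over p c is chosen so that, after multiplication by t^(-p) / q, it equals [e]. *)
pose P := (p * c + e * q / t `^ (- p))%R.
have Pc : (p * c < P)%R by rewrite ltrDl divr_gt0 ?mulr_gt0.
have P0 : (0 < P)%R by apply: le_lt_trans Pc; rewrite mulr_ge0 ?(ltW p0).
pose D := (P `^ p^-1)%R; have D0 : (0 < D)%R by exact: powR_gt0.
have DP : (D `^ p = P)%R by rewrite -powRrM mulVf ?gt_eqF// powRr1 ?ltW.
have xD : x `^ q <= (t `^ (- p) * P)%:E.
  have -> : (t `^ (- p) * P = (t `^ (1 - p) * D `^ (p - 1)) `^ q)%R.
    rewrite powRM ?powR_ge0// -DP -(powRrM t) -(powRrM D).
    by congr (_ `^ _ * _ `^ _)%R; lra.
  rewrite -poweR_EFin; apply: gt0_ler_poweR; first exact: ltW.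
  - by rewrite in_itv/= x0 leey.
  - by rewrite in_itv/= leey lee_fin mulr_ge0 ?powR_ge0.
  - by apply: H; rewrite ?DP.
have qV : 0 <= (q^-1)%:E by rewrite lee_fin invr_ge0 ltW.
apply: (le_trans (leeD2l _ (lee_wpmul2l qV xD))).
rewrite -EFinM -EFinD lee_fin /P le_eqVlt; apply/orP; left; apply/eqP.
have E : (q^-1 * p = p - 1)%R.
  by apply: (mulfI (lt0r_neq0 q0)); rewrite mulrA divff ?gt_eqF// mul1r; lra.
have -> : (q^-1 * (t `^ (- p) * (p * c + e * q / t `^ (- p))) =
           (q^-1 * p) * t `^ (- p) * c + e)%R.
  by field; rewrite !gt_eqF.
rewrite E; ring.
Qed.

End hamilton_jacobi.

(** * Derivatives of the Hopf-Lax infimum in time *)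

Section time_derivative.
Context {R : realType} {X : choiceType}.
Context (d : X -> X -> \bar R) (f : X -> \bar R).
Context (p : R) (y : X).
Hypotheses (dm : asym_ext_metric d) (f_gtNy : forall x, -oo < f x).
Hypotheses (p1 : (1 < p)%R) (yD : Dset d f y).

Let S := adm d f y.
Let fv (x : X) : R := fine (f x).
Let A := cost d p y.
Let wt (t : R) : R := (t `^ (1 - p))%R.
Let G := env S fv A.

(** For small increments the weight stays above [a], so the extended-valued infimum is the real
    envelope there. Any filter finer than the punctured neighbourhoods of 0 is allowed, which covers
    both one-sided limits and the two-sided one. *)
Lemma Qt_derive_along (F : set_system R) a t l : Filter F ->
  F `=>` (0%R : R)^' -> (0 < t)%R -> env_dom S fv A a -> (a < wt t)%R ->
  ((G (wt (t + h)) - G (wt t)) / h)%R @[h --> F] --> l ->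
  is_derive_along F (fun s => Qt d p f s y) t l.
Proof.
move=> FF F0 t0 da as_ GF; rewrite /is_derive_along.
have A_ge0 : forall x, S x -> (0 <= A x)%R := fun x Sx => cost_ge0 p1 Sx.
have ds := env_dom_le A_ge0 da (ltW as_).
have GE : ((G (wt (t + h)) - G (wt t)) / h)%:E @[h --> F] --> l%:E.
  by apply: cvg_EFin => //; exact: nearW.
apply: (cvg_trans _ GE); apply: near_eq_cvg; apply: F0; near=> h.
have h0 : (h != 0)%R by near: h; exact: nbhs_dnbhs_neq.
have th0 : (0 < t + h)%R.
  have : (- t < h)%R; last by lra.
  by near: h; apply: nbhs_dnbhs; apply: lt_nbhsr; lra.
have ath : (a < wt (t + h))%R.
  near: h; apply: nbhs_dnbhs.
  exact: (cvgr_gt _ (powR1B_cvg t0) _ as_).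
have dh := env_dom_le A_ge0 da (ltW ath).
rewrite (Qt_env dm f_gtNy p1 yD t0 ds) (Qt_env dm f_gtNy p1 yD th0 dh).
by rewrite inver (negbTE h0).
Unshelve. all: by end_near. Qed.

Lemma Qt_derive_right a t : (0 < t)%R -> env_dom S fv A a -> (a < wt t)%R ->
  is_derive_along 0^'+ (fun s => Qt d p f s y) t
    (env_dl S fv A (wt t) * ((1 - p) * t `^ (- p))).
Proof.
move=> t0 da as_.
have A_ge0 : forall x, S x -> (0 <= A x)%R := fun x Sx => cost_ge0 p1 Sx.
apply: (@Qt_derive_along 0^'+ a t) => //.
  move=> P [e e0 eP]; exists e => // h he h0.
  by apply: eP => //; rewrite gt_eqF.
apply: quotient_powR1B_cvg_right => //.
exact: (env_dl_cvg (adm0 yD) A_ge0 da as_).1.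
Qed.

Lemma Qt_derive_left a t : (0 < t)%R -> env_dom S fv A a -> (a < wt t)%R ->
  is_derive_along 0^'- (fun s => Qt d p f s y) t
    (env_dr S fv A (wt t) * ((1 - p) * t `^ (- p))).
Proof.
move=> t0 da as_.
have A_ge0 : forall x, S x -> (0 <= A x)%R := fun x Sx => cost_ge0 p1 Sx.
apply: (@Qt_derive_along 0^'- a t) => //.
  move=> P [e e0 eP]; exists e => // h he h0.
  by apply: eP => //; rewrite lt_eqF.
apply: quotient_powR1B_cvg_left => //.
exact: (env_dr_cvg (adm0 yD) A_ge0 da as_).1.
Qed.

Lemma Qt_derive a t : (0 < t)%R -> env_dom S fv A a -> (a < wt t)%R ->
  env_dr S fv A (wt t) = env_dl S fv A (wt t) ->
  is_derive_along (0%R : R)^' (fun s => Qt d p f s y) t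
    (env_dr S fv A (wt t) * ((1 - p) * t `^ (- p))).
Proof.
move=> t0 da as_ drl.
have A_ge0 : forall x, S x -> (0 <= A x)%R := fun x Sx => cost_ge0 p1 Sx.
apply: (@Qt_derive_along (0%R : R)^' a t) => //.
apply: (@cvg_at_right_left_dnbhs _ R^o).
  rewrite drl; apply: quotient_powR1B_cvg_right => //.
  exact: (env_dl_cvg (adm0 yD) A_ge0 da as_).1.
apply: quotient_powR1B_cvg_left => //.
exact: (env_dr_cvg (adm0 yD) A_ge0 da as_).1.
Qed.

End time_derivative.

Theorem theoremA8 (R : realType) (X : topologicalType) (d : X -> X -> \bar R)
    (f : X -> \bar R) (p q : R)
    (Xd : fwd_ext_polish d)
    (f_gtNy : forall x, -oo < f x) (f_proper : exists x, f x < +oo)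
    (p1 : (1 < p)%R) (q1 : (1 < q)%R) (pq : (p^-1 + q^-1 = 1)%R)
    (y : X) (yD : Dset d f y) :
  (forall t : R, (0 < t)%R -> t%:E < tstar d p f y ->
    (exists l : R,
       is_derive_along 0^'+ (fun s => Qt d p f s y) t l /\
       l%:E + (q^-1)%:E *
         ((slope_desc d (Qt d p f t) y / pt_reversibility d y) `^ q) <= 0) /\
    (exists l : R,
       is_derive_along 0^'- (fun s => Qt d p f s y) t l /\
       l%:E + (slope_asc d (Qt d p f t) y `^ q) / q%:E <= 0)) /\
  countable [set t : R | [/\ (0 < t)%R, t%:E < tstar d p f y &
    ~ (exists l : R,
         is_derive_along (0%R : R)^' (fun s => Qt d p f s y) t l /\
         l%:E + (slope_asc d (Qt d p f t) y `^ q) / q%:E <= 0)]].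
Proof.
have dm : asym_ext_metric d := fem_metric (fep_metric Xd).
pose S := adm d f y; pose fv x := fine (f x); pose A := cost d p y.
have S0 : S !=set0 := adm0 yD.
have A_ge0 : forall x, S x -> (0 <= A x)%R := fun x Sx => cost_ge0 p1 Sx.
have interior t : (0 < t)%R -> t%:E < tstar d p f y ->
    exists2 a, env_dom S fv A a & (a < t `^ (1 - p))%R.
  move=> t0 /(tstar_dom dm f_gtNy p1 yD t0)[t' tt' dt'].
  by exists (t' `^ (1 - p))%R => //; exact: ltr_powR1B.
have asc t : (0 < t)%R -> t%:E < tstar d p f y ->
    (env_dr S fv A (t `^ (1 - p)) * ((1 - p) * t `^ (- p)))%:E +
    (slope_asc d (Qt d p f t) y `^ q) / q%:E <= 0.
  move=> t0 tt; have [a da as_] := interior t t0 tt.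
  rewrite inver gt_eqF ?(lt_trans ltr01)// muleC.
  apply: hamilton_jacobi_le => //.
  - exact: (env_dr_ge0 S0 A_ge0 da as_).
  - exact: slope_asc_ge0.
  - by move=> D D0 HD; exact: (slope_asc_le dm f_gtNy p1 q1 pq yD t0 da as_).
split=> [t t0 tt|].
  have [a da as_] := interior t t0 tt.
  split; last first.
    exists (env_dr S fv A (t `^ (1 - p)) * ((1 - p) * t `^ (- p)))%R.
    by split; [exact: (Qt_derive_left dm f_gtNy p1 yD t0 da as_)|exact: asc].
  exists (env_dl S fv A (t `^ (1 - p)) * ((1 - p) * t `^ (- p)))%R.
  split; first exact: (Qt_derive_right dm f_gtNy p1 yD t0 da as_).
  have [l [l1 -> lP]] := pt_reversibilityP dm y (fep_metric Xd).
  have l0 : (0 < l)%R := lt_le_trans ltr01 l1.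
  rewrite inver gt_eqF//.
  apply: hamilton_jacobi_le => //.
  - apply: le_trans (env_dr_ge0 S0 A_ge0 da as_) _.
    exact: (env_dr_le_dl S0 A_ge0 da as_).
  - by rewrite mule_ge0 ?(slope_desc_ge0 dm)// lee_fin invr_ge0 ltW.
  move=> D D0 HD; rewrite lee_pdivrMr// -EFinM.
  set K := (t `^ (1 - p) * D `^ (p - 1))%R.
  have K0 : (0 < K)%R by rewrite mulr_gt0// powR_gt0.
  apply/lee_addgt0Pr => e e0.
  (* The reversibility constant is available on a ball only for values above [l]; this one costs
     exactly [e] after multiplication by [K]. *)
  have lk : (l < l + e / K)%R by rewrite ltrDl divr_gt0.
  have [r r0 rP] := lP _ lk.
  have -> : (K * l)%:E + e%:E = (K * (l + e / K))%:E.
    by rewrite -EFinD mulrDr mulrCA divff ?mulr1// gt_eqF.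
  apply: (slope_desc_le dm f_gtNy p1 q1 pq yD t0 da as_ D0 HD _ r0).
    exact: lt_trans l0 lk.
  by move=> z zr; apply: rP => //; rewrite (aem_eq0 dm y y).2// lte_fin.
(* Every exceptional time is the image of a kink under the inverse power: where the one-sided
   derivatives of G agree, the two-sided time derivative exists and [asc] applies. *)
apply: sub_countable (countable_env_kink fv S0 A_ge0).
apply: (card_le_trans _ (card_image_le (fun s : R => s `^ (1 - p)^-1)%R _)).
apply: subset_card_le => t [t0 tt nd].
exists (t `^ (1 - p))%R; last first.
  rewrite -powRrM mulfV ?powRr1 ?ltW//.
  by rewrite lt_eqF// subr_lt0.
split; first exact: interior.
apply/negP => /eqP drl; apply: nd.
exists (env_dr S fv A (t `^ (1 - p)) * ((1 - p) * t `^ (- p)))%R.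
have [a da as_] := interior t t0 tt.
by split; [exact: (Qt_derive dm f_gtNy p1 yD t0 da as_)|exact: asc].
Qed.
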